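(* For every $\epsilon>0$, the set of limit points of $\mathcal{Z}$ that lie in the interval $(\tfrac13-\epsilon,\tfrac13)$ is uncountable.
   Context: For a rational number $a/b$ in lowest terms with $b\ge 2$, set $\mathcal{Z}(a/b)=\min_{q\in\mathbb{N},\,0<q<b} q\,\|qa/b\|$, where $\|x\|$ denotes the distance from $x$ to the nearest integer. The $\mathcal{Z}$-spectrum is the set $\mathcal{Z}=\{\mathcal{Z}(a/b): a/b\in\mathbb{Q}\}$. *)

(* Defs.v *)
From HB Require Import structures.
From mathcomp Require Import all_boot all_order all_algebra.
From mathcomp Require Import all_classical all_reals all_analysis.
Set Implicit Arguments. Unset Strict Implicit. Unset Printing Implicit Defensive.
Import Order.TTheory GRing.Theory Num.Theory.
Import numFieldNormedType.Exports.
Local Open Scope ring_scope.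
Local Open Scope classical_set_scope.

Definition dist_int (R : realType) (x : R) : R :=
  Num.min (x - (Num.floor x)%:~R) ((Num.ceil x)%:~R - x).

(* isZ r x  <->  x = Z(r) = min_{0<q<b} q ||q r||, where r = a/b in lowest
   terms (b = denq r); only meaningful when denq r >= 2. *)
Definition isZ (R : realType) (r : rat) (x : R) : Prop :=
  (exists q : nat, [/\ (0 < q)%N, (q%:R < (denq r)%:~R :> R)
                     & x = q%:R * dist_int (q%:R * ratr r)]) /\
  (forall q : nat, (0 < q)%N -> (q%:R < (denq r)%:~R :> R) ->
                   x <= q%:R * dist_int (q%:R * ratr r)).

Definition Zspectrum (R : realType) : set R :=
  [set x | exists r : rat, (1 < denq r)%R /\ isZ r x].

(* Main.v *)
(** For [a/b = [0; a_1, ..., a_n]] with convergents [p_k/q_k], best approximation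
    gives [Z(a/b) = min_k q_k ||q_k a/b|| = 1 / max_k lambda_k], where
    [lambda_k = a_{k+1} + [0; a_{k+2}, ..., a_n] + [0; a_k, ..., a_1]].
    Take the words [1^(2M+1) 2 2 1^(2m) x_1 x_1 1^(2m) x_2 x_2 ... 1^(2m)] with
    [x_i] in [{1, 2}].  With [g = [0; 1, 1, ...]] one has
    [2 + g + 1/(2 + g) = 3].  An even run of 1s followed by a 2 or by the end of
    the word has value at most [g], whereas the initial odd run [1^(2M+1)] has
    value [rho] slightly larger than [g].  So, for [m] large with respect to
    [M], the maximum of [lambda] is attained at the first 2, where it equals
    [2 + rho + 1/(2 + tau)], [tau] being the value of [1^(2m) x_1 x_1 ...].
    Extending the word by more blocks makes [tau] increase strictly to the value
    of an infinite word, and infinite words form a Cantor set of values. *)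

Require Import Defs.
From HB Require Import structures.
From mathcomp Require Import all_boot all_order all_algebra.
From mathcomp Require Import all_classical all_reals all_analysis.
From mathcomp Require Import zify ring lra.
Import Order.TTheory GRing.Theory Num.Theory.
Import numFieldNormedType.Exports.
Local Open Scope ring_scope.
Local Open Scope classical_set_scope.

(** * Continuants and best approximations *)

(* [ctn [:: a_1; ...; a_n]] is the pair of continuants
   [(K(a_1, ..., a_n), K(a_2, ..., a_n))].  A factorisation of a word is written
   [catrev l (a :: r)], the left part [l] being read from right to left, so that
   [(ctn l).1] is the denominator of the convergent [rev l]. *)
Definition ctn (s : seq nat) : nat * nat :=
  foldr (fun a p => (a * p.1 + p.2, p.1)%N) (1, 0)%N s.

Definition cf (R : realType) (s : seq nat) : R :=
  foldr (fun a x => (a%:R + x)^-1) 0 s.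

Definition positive_word (s : seq nat) : bool := all (leq 1) s.

Lemma ctn_gt0 (s : seq nat) : positive_word s -> (0 < (ctn s).1)%N.
Proof.
by elim: s => //= a s IH /andP[a0 /IH]; rewrite addn_gt0 muln_gt0 a0 => ->.
Qed.

Lemma ctn_coprime (s : seq nat) : coprime (ctn s).2 (ctn s).1.
Proof.
elim: s => //= a s IH.
by rewrite /coprime gcdnMDl gcdnC -/(coprime _ _) .
Qed.

Lemma positive_word_catrev (l r : seq nat) :
  positive_word (catrev l r) = positive_word l && positive_word r.
Proof. by rewrite /positive_word catrevE all_cat all_rev. Qed.

(** Euler's rule for continuants; the induction carries letters across the split. *)
Lemma ctn_catrev (l r : seq nat) :
  ((ctn (catrev l r)).1 = (ctn l).1 * (ctn r).1 + (ctn l).2 * (ctn r).2)%N.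
Proof. by elim: l r => [|c l IH] r /=; [lia | rewrite IH /=; nia]. Qed.

Lemma ctn_approx (l r : seq nat) : exists p : int,
  `|(ctn l).1%:Z * (ctn (catrev l r)).2%:Z - p * (ctn (catrev l r)).1%:Z|
  = (ctn r).2%:Z.
Proof.
set a := (ctn (catrev l r)).2%:Z; set b := (ctn (catrev l r)).1%:Z.
(* The recurrence involves two consecutive convergents, whose errors carry opposite signs [e] and
   [- e]. *)
suff [e [p [p' [eE hp _]]]] : exists (e p p' : int),
    [/\ `|e| = 1, (ctn l).1%:Z * a - p * b = e * (ctn r).2%:Z
      & (ctn l).2%:Z * a - p' * b = - e * (ctn r).1%:Z].
  by exists p; rewrite hp normrM eE mul1r.
rewrite {}/a {}/b; elim: l r => [|c l IH] r /=.
  by exists 1, 0, 1; split; rewrite ?normr1//; ring.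
have [e [p [p' [eE /= h1 h2]]]] := IH (c :: r).
exists (- e), (c%:Z * p + p'), p; split; first by rewrite normrN.
- rewrite PoszD PoszM.
  have -> : (c%:Z * (ctn l).1 + (ctn l).2) * (ctn (catrev l (c :: r))).2
    - (c%:Z * p + p') * (ctn (catrev l (c :: r))).1
    = c%:Z * ((ctn l).1%:Z * (ctn (catrev l (c :: r))).2
              - p * (ctn (catrev l (c :: r))).1)
      + ((ctn l).2%:Z * (ctn (catrev l (c :: r))).2
         - p' * (ctn (catrev l (c :: r))).1) by ring.
  by rewrite h1 h2 PoszD PoszM; ring.
- by rewrite h1; ring.
Qed.

(* In the lattice of the points [(q, p b - q a)], the last two convergents of
   [rev l] give a basis whose second entries are, up to a common sign,
   [(ctn r).1] and [- (ctn r).2]; [i] and [j] are the coordinates in it. *)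
Lemma best_approximation (l r : seq nat) (i j : int) :
  positive_word l -> positive_word r ->
  (ctn l).1%:Z <= i * (ctn l).2%:Z + j * (ctn l).1%:Z ->
  i * (ctn l).2%:Z + j * (ctn l).1%:Z < (ctn (catrev l r)).1%:Z ->
  exists l' a r', [/\ catrev l' (a :: r') = catrev l r,
    (ctn l').1%:Z <= i * (ctn l).2%:Z + j * (ctn l).1%:Z
    & (ctn r').1%:Z <= `|i * (ctn r).1%:Z - j * (ctn r).2%:Z| ].
Proof.
elim: r l i j => [|a r IH] l i j pl pr lex ltx.
  by move: ltx; rewrite ctn_catrev /=; lia.
have /andP[a0 pr'] := pr.
have q0 := ctn_gt0 l pl; have d0 := ctn_gt0 r pr'.
set x := i * _ + _ in lex ltx *.
have xE : x = (j - a%:Z * i) * (ctn l).1%:Z + i * (ctn (a :: l)).1%:Z.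
  by rewrite /x /= PoszD PoszM; ring.
have yE : i * (ctn (a :: r)).1%:Z - j * (ctn (a :: r)).2%:Z =
    - ((j - a%:Z * i) * (ctn r).1%:Z - i * (ctn r).2%:Z).
  by rewrite /= PoszD PoszM; ring.
(* Either the split moves past [a], with new coordinates [j - a * i] and [i], or [x] lies between
   two consecutive denominators. *)
have [xlt|xge] := ltP x (ctn (a :: l)).1%:Z; last first.
  have [||||l' [a' [r' [h1 h2 h3]]]] := IH (a :: l) (j - a%:Z * i) i.
  - by rewrite /= a0.
  - by [].
  - by rewrite -[X in _ <= X]xE.
  - by rewrite -[X in X < _]xE.
  exists l', a', r'; split => //; first by rewrite xE.
  by rewrite yE normrN.
exists l, a, r; split => //; rewrite yE normrN.
move: xE xlt lex; set t := j - _; set q2 := (ctn (a :: l)).1.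
set q := (ctn l).1 in q0 *; set d := (ctn r).1 in d0 *; set d2 := (ctn r).2.
move: x {yE IH ltx} => x -> h1 h2.
(* From [q <= x < q2], [t] is nonzero and its sign is opposite to that of a nonzero [i], so the
   terms of [t * d - i * d2] cannot cancel. *)
have [i0|i0|i0] := ltgtP i 0.
- have t1 : 1 <= t by nia.
  by rewrite ger0_norm; nia.
- have t1 : t <= -1 by nia.
  by rewrite ler0_norm; nia.
- have t1 : 1 <= t by nia.
  by rewrite ger0_norm; nia.
Qed.

(** * Elements of the spectrum given by words *)

Section Spectrum.
Variable R : realType.
Implicit Types (x L : R) (l r w : seq nat).

Lemma dist_int_le x (p : int) : dist_int x <= `|x - p%:~R|.
Proof.
rewrite /dist_int ge_min; have [px|xp] := leP p%:~R x.
  by rewrite ger0_norm ?subr_ge0// lerD2l lerN2 ler_int floor_ge_int px.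
rewrite ltr0_norm ?subr_lt0// opprB lerD2r ler_int ceil_le_int.
by rewrite (ltW xp) orbT.
Qed.

Lemma dist_int_attained x : exists p : int, dist_int x = `|x - p%:~R|.
Proof.
rewrite /dist_int minEle; case: ifP => _.
  by exists (Num.floor x); rewrite ger0_norm ?subr_ge0 ?floor_le.
by exists (Num.ceil x); rewrite ler0_norm ?subr_le0 ?ceil_ge// opprB.
Qed.

Lemma cf_ge0 l : 0 <= cf R l.
Proof. by elim: l => //= a l IH; rewrite invr_ge0 addr_ge0. Qed.

Lemma cf_ctn l : positive_word l -> cf R l = (ctn l).2%:R / (ctn l).1%:R.
Proof.
elim: l => [_|a l IH /andP[a0 pl]] /=; first by rewrite mul0r.
have K0 : (ctn l).1%:R != 0 :> R by rewrite pnatr_eq0 -lt0n ctn_gt0.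
have D0 : a%:R * (ctn l).1%:R + (ctn l).2%:R != 0 :> R.
  by rewrite -natrM -natrD pnatr_eq0 -lt0n addn_gt0 muln_gt0 a0 ctn_gt0.
by rewrite IH// natrD natrM; field; rewrite K0 D0.
Qed.

(** Euler's rule with both continuants factored out; the last factor is [lambda] at [a]. *)
Lemma ctn_split l a r : positive_word l -> positive_word r ->
  (ctn (catrev l (a :: r))).1%:R =
  (ctn l).1%:R * (ctn r).1%:R * (a%:R + cf R l + cf R r).
Proof.
move=> pl pr; rewrite ctn_catrev /= !cf_ctn// !(natrD, natrM).
have l0 : (ctn l).1%:R != 0 :> R by rewrite pnatr_eq0 -lt0n ctn_gt0.
have r0 : (ctn r).1%:R != 0 :> R by rewrite pnatr_eq0 -lt0n ctn_gt0.
by field; rewrite l0 r0.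
Qed.

(** Provides the strict bound [q < b] of [isZ]. An empty [l] has denominator 1, whence the second
    hypothesis. *)
Lemma ctn_prefix_lt l a r : positive_word (catrev l (a :: r)) ->
  (1 < (ctn (catrev l (a :: r))).1)%N ->
  ((ctn l).1 < (ctn (catrev l (a :: r))).1)%N.
Proof.
rewrite positive_word_catrev => /andP[pl /andP[a0 pr]].
case: l pl => [|c l] //= /andP[c0 /(ctn_gt0 _) l0] _.
have r0 := ctn_gt0 _ pr; rewrite (ctn_catrev (c :: l) (a :: r)) /=.
have s0 : (0 < a * (ctn r).1 + (ctn r).2)%N by rewrite addn_gt0 muln_gt0 a0 r0.
have p0 : (0 < (ctn l).1 * (ctn r).1)%N by rewrite muln_gt0 l0 r0.
by rewrite -addn1 leq_add// leq_pmulr.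
Qed.

(** Best approximation bounds each candidate below by some [1 / lambda], and [q = (ctn l0).1]
    attains [1 / L]. *)
Lemma Zspectrum_word L l0 a0 r0 (w := catrev l0 (a0 :: r0)) :
  positive_word w -> (1 < (ctn w).1)%N ->
  a0%:R + cf R l0 + cf R r0 = L ->
  (forall l a r, catrev l (a :: r) = w -> a%:R + cf R l + cf R r <= L) ->
  Zspectrum L^-1.
Proof.
move=> pw b1 LE Lmax.
set a := (ctn w).2; set b := (ctn w).1 in b1 *.
have b0 : (0 < b)%N by lia.
have bR0 : 0 < b%:R :> R by rewrite ltr0n.
pose rho : rat := a%:R / b%:R.
have denE : denq rho = b%:Z.
  rewrite /rho !pmulrn coprimeq_den; last by rewrite /= ctn_coprime.
  by rewrite /= eqz_nat (negbTE (lt0n_neq0 b0)).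
have rhoE : ratr rho = a%:R / b%:R :> R by rewrite /rho fmorph_div /= !ratr_nat.
have distE (q : nat) (p : int) :
    `|q%:R * ratr rho - p%:~R| = `|q%:Z * a - p * b|%:~R / b%:R :> R.
  rewrite rhoE; have -> : q%:R * (a%:R / b%:R) - p%:~R
     = (q%:R * a%:R - p%:~R * b%:R) / b%:R :> R by field; rewrite gt_eqF.
  by rewrite normrM normfV (gtr0_norm bR0) intr_norm rmorphB !rmorphM /= -!pmulrn.
have lower (q : nat) : (0 < q)%N -> (q < b)%N ->
    L^-1 <= q%:R * dist_int (q%:R * ratr rho) :> R.
  move=> q0 qb; have [p ->] := dist_int_attained (q%:R * ratr rho).
  rewrite distE.
  (* For the empty left part, the coordinates [p] and [q] describe the point [(q, p b - q a)]
     itself. *)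
  have [||||l [c [r [wE h1 h2]]]] := @best_approximation [::] w p q%:Z => //=.
  - by lia.
  - by rewrite /=; move: qb; rewrite /b; lia.
  have {}wE : catrev l (c :: r) = w := wE.
  have := pw; rewrite -wE positive_word_catrev => /andP[pl /andP[c0 pr]].
  have bE := ctn_split l c r pl pr; rewrite wE -/b in bE.
  have lR0 : 0 < (ctn l).1%:R :> R by rewrite ltr0n ctn_gt0.
  have rR0 : 0 < (ctn r).1%:R :> R by rewrite ltr0n ctn_gt0.
  have lam0 : 0 < c%:R + cf R l + cf R r.
    by rewrite -addrA ltr_wpDr ?addr_ge0 ?cf_ge0// ltr0n.
  apply: (@le_trans _ _ ((ctn l).1%:R * (ctn r).1%:R / b%:R)).
    rewrite bE invfM mulrA mulfV ?mulf_neq0 ?gt_eqF// mul1r.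
    by rewrite lef_pV2 ?posrE//; [exact: Lmax | exact: lt_le_trans (Lmax _ _ _ wE)].
  rewrite mulrA ler_pM2r ?invr_gt0//; apply: ler_pM => //.
    by move: h1; rewrite mulr0 add0r mulr1 lez_nat ler_nat.
  rewrite [_%:R]pmulrn ler_int (le_trans h2)//.
  by rewrite -normrN opprB mulrC.
have wE : catrev l0 (a0 :: r0) = w by [].
have := pw; rewrite positive_word_catrev => /andP[pl /andP[c0 pr]].
have l00 := ctn_gt0 _ pl; have r00 := ctn_gt0 _ pr.
exists rho; rewrite /isZ denE; split; first by rewrite ltz_nat.
split; last first.
  by move=> q q0 qb; apply: lower => //; move: qb; rewrite -pmulrn ltr_nat.
have qb : ((ctn l0).1 < b)%N by apply: ctn_prefix_lt.
exists (ctn l0).1; split => //; first by rewrite -pmulrn ltr_nat.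
apply/eqP; rewrite eq_le lower//=.
have [p] := ctn_approx l0 (a0 :: r0); rewrite -/w -/a -/b => hp.
apply: (@le_trans _ _ ((ctn l0).1%:R * `|(ctn l0).1%:R * ratr rho - p%:~R|)).
  by rewrite ler_wpM2l// dist_int_le.
rewrite distE hp /= -pmulrn mulrA.
have := ctn_split l0 a0 r0 pl pr; rewrite wE -/b => ->.
by rewrite LE invfM mulrA mulfV ?mul1r// mulf_neq0// pnatr_eq0 -lt0n.
Qed.

End Spectrum.

(** * Runs of 1s and the golden mean *)

Section GoldenMap.
Variable R : realType.
Implicit Types (x y z : R) (s : seq nat).

Definition golden : R := (Num.sqrt 5 - 1) / 2.

(** Effect on the value of prepending two letters 1; an even number of inversions makes the map
    increasing. *)
Definition ones_step z : R := (1 + (1 + z)^-1)^-1.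

Lemma golden_eq : golden ^+ 2 = 1 - golden.
Proof.
have s5 : Num.sqrt 5 ^+ 2 = 5 :> R by rewrite sqr_sqrtr.
rewrite /golden; move: s5; set s := Num.sqrt 5 => s5.
have -> : ((s - 1) / 2) ^+ 2 = (s ^+ 2 - 2 * s + 1) / 4 by field.
by rewrite s5; field.
Qed.

Lemma golden_bounds : 2^-1 < golden < 1.
Proof.
have : 2 < (Num.sqrt 5 : R) < 3.
  have s0 : 0 <= Num.sqrt 5 :> R := sqrtr_ge0 5.
  have s5 : Num.sqrt 5 ^+ 2 = 5 :> R by rewrite sqr_sqrtr.
  by apply/andP; split; nra.
by rewrite /golden => /andP[s2 s3]; apply/andP; split; lra.
Qed.

Lemma ones_stepE z : 0 <= z -> ones_step z = 1 - (2 + z)^-1.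
Proof. by move=> z0; rewrite /ones_step; field; lra. Qed.

Lemma ones_step_ge0 z : 0 <= z -> 0 <= ones_step z.
Proof. by move=> z0; rewrite invr_ge0 addr_ge0// invr_ge0 addr_ge0. Qed.

Lemma ones_step_lt x y : 0 <= x -> x < y -> ones_step x < ones_step y.
Proof.
move=> x0 xy; rewrite !ones_stepE ?(le_trans x0 (ltW xy))//.
by rewrite ltrD2l ltrN2 ltf_pV2 ?posrE; lra.
Qed.

(** Another form of [(2 + g) + (2 + g)^-1 = 3], the critical value. *)
Lemma golden_inv : (2 + golden)^-1 = 1 - golden.
Proof.
have /andP[g2 _] := golden_bounds; have gE := golden_eq.
apply: (mulfI (_ : 2 + golden != 0)); first by lra.
by rewrite mulfV; [nra | lra].
Qed.

Lemma ones_step_golden : ones_step golden = golden.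
Proof.
by have /andP[g2 _] := golden_bounds; rewrite ones_stepE ?golden_inv; lra.
Qed.

Lemma ones_step_contract z : 0 <= z ->
  `|ones_step z - golden| <= `|z - golden| / 4.
Proof.
move=> z0; have /andP[g2 _] := golden_bounds.
rewrite -{1}ones_step_golden !ones_stepE; [|lra|lra].
have -> : 1 - (2 + z)^-1 - (1 - (2 + golden)^-1) =
    (z - golden) / ((2 + z) * (2 + golden)) by field; lra.
rewrite normrM normfV ler_wpM2l// (@gtr0_norm _ (_ * _)) ?lef_pV2 ?posrE; nra.
Qed.

Lemma iter_ones_ge0 m z : 0 <= z -> 0 <= iter m ones_step z.
Proof. by move=> z0; elim: m => //= m; exact: ones_step_ge0. Qed.

Lemma iter_ones_lt m x y : 0 <= x -> x < y ->
  iter m ones_step x < iter m ones_step y.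
Proof.
move=> x0 xy; elim: m => //= m IH.
by apply: ones_step_lt => //; exact: iter_ones_ge0.
Qed.

Lemma iter_ones_le m x y : 0 <= x -> x <= y ->
  iter m ones_step x <= iter m ones_step y.
Proof.
move=> x0; rewrite le_eqVlt => /predU1P[->//|xy].
by apply/ltW/iter_ones_lt.
Qed.

Lemma iter_ones_golden m : iter m ones_step golden = golden.
Proof. by elim: m => //= m ->; exact: ones_step_golden. Qed.

Lemma iter_ones_contract m z : 0 <= z -> z <= 1 ->
  `|iter m ones_step z - golden| <= 4^-1 ^+ m.
Proof.
move=> z0 z1; have /andP[g2 g1] := golden_bounds.
elim: m => [|m IH] /=; first by rewrite expr0 ler_norml; apply/andP; split; lra.
rewrite (le_trans (ones_step_contract (iter m ones_step z) _))//.
  exact: iter_ones_ge0.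
by rewrite exprSr ler_pM2r ?invr_gt0.
Qed.

Lemma cf_ones m s : cf R (nseq m.*2 1%N ++ s) = iter m ones_step (cf R s).
Proof. by elim: m => //= m ->. Qed.

End GoldenMap.

(** * Tails coded by binary digits *)

Section Tails.
Variable R : realType.
Implicit Types (x y z : R) (b : bool) (m : nat) (bs : seq bool).
Local Notation g := (golden R).

Definition digit b : nat := if b then 2 else 1.

(** Digits are doubled so that each block has even length and acts on values by an increasing
    map. *)
Definition tail_word m bs : seq nat :=
  foldr (fun b s => nseq m.*2 1%N ++ [:: digit b, digit b & s])
        (nseq m.*2 1%N) bs.

Definition pair_step b z : R := ((digit b)%:R + ((digit b)%:R + z)^-1)^-1.

Definition block_step m b z : R := iter m (@ones_step R) (pair_step b z).

Lemma pair_step_gt0 b z : 0 <= z -> 0 < pair_step b z.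
Proof.
move=> z0; have d0 : 0 < (digit b)%:R :> R by case: b; rewrite ltr0n.
by rewrite invr_gt0 ltr_pwDl// invr_ge0 addr_ge0// ltW.
Qed.

Lemma pair_step_lt b x y : 0 <= x -> x < y -> pair_step b x < pair_step b y.
Proof.
move=> x0 xy; have d0 : 0 < (digit b)%:R :> R by case: b; rewrite ltr0n.
have y0 : 0 <= y by apply: le_trans (ltW xy).
have pos z : 0 <= z -> 0 < (digit b)%:R + z by move=> z0; rewrite ltr_pwDl.
have x1 := pos x x0; have y1 := pos y y0.
rewrite /pair_step ltf_pV2 ?posrE; [|by apply/pos/ltW; rewrite invr_gt0..].
by rewrite ltrD2l ltf_pV2 ?posrE// ltrD2l.
Qed.

(** The bound 1/2 lies below [g] and separates the digits: [pair_step false] exceeds 1/2 at positive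
    arguments. *)
Lemma pair_step_true_le z : 0 <= z -> pair_step true z <= 2^-1.
Proof.
move=> z0; have i0 : 0 <= (2 + z)^-1 by rewrite invr_ge0 addr_ge0.
by rewrite /pair_step /= lef_pV2 ?posrE; lra.
Qed.

Lemma pair_step_le_golden b z : 0 <= z -> z <= g -> pair_step b z <= g.
Proof.
move=> z0 zg; have /andP[g2 g1] := golden_bounds R; case: b.
  by rewrite (le_trans (pair_step_true_le _ z0))// ltW.
(* For the digit 1, [pair_step] is [ones_step], which fixes [g]. *)
have := @iter_ones_le R 1 z g z0 zg.
by rewrite /= ones_step_golden.
Qed.

Lemma block_step_ge0 m b z : 0 <= z -> 0 <= block_step m b z.
Proof. by move=> z0; apply/iter_ones_ge0/ltW/pair_step_gt0. Qed.

Lemma foldr_block_step_lt m bs x y : 0 <= x -> x < y ->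
  0 <= foldr (block_step m) x bs < foldr (block_step m) y bs.
Proof.
move=> x0 xy; elim: bs => [|b bs /andP[IH0 IH]] /=; first by rewrite x0.
rewrite block_step_ge0//=; apply: iter_ones_lt; first exact/ltW/pair_step_gt0.
exact: pair_step_lt.
Qed.

Lemma foldr_block_step_le m bs x y : 0 <= x -> x <= y ->
  foldr (block_step m) x bs <= foldr (block_step m) y bs.
Proof.
move=> x0; rewrite le_eqVlt => /predU1P[->//|xy].
by have /andP[_ /ltW] := foldr_block_step_lt m bs x y x0 xy.
Qed.

Lemma cf_tail_word m bs : cf R (tail_word m bs) =
  foldr (block_step m) (iter m (@ones_step R) 0) bs.
Proof.
elim: bs => [|b bs IH] /=; first by rewrite -[nseq _ _]cats0 cf_ones.
by rewrite cf_ones /= IH.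
Qed.

Lemma iter_ones_bounds m z : 0 <= z -> z <= g ->
  g - 4^-1 ^+ m <= iter m (@ones_step R) z <= g.
Proof.
move=> z0 zg; have /andP[g2 g1] := golden_bounds R.
have := @iter_ones_contract R m z z0 (le_trans zg (ltW g1)).
have := @iter_ones_le R m z g z0 zg; rewrite iter_ones_golden ler_norml.
by move=> h1 /andP[h2 _]; apply/andP; split; lra.
Qed.

Lemma cf_tail_word_bounds m bs : g - 4^-1 ^+ m <= cf R (tail_word m bs) <= g.
Proof.
have /andP[g2 g1] := golden_bounds R; have g0 : 0 <= g by lra.
(* Every tail begins with [2m] letters 1, so its value is an [m]-fold iterate from a point of
   [[0, g]]. *)
rewrite cf_tail_word; suff [z [z0 zg ->]] : exists z, [/\ 0 <= z, z <= g &
  foldr (block_step m) (iter m (@ones_step R) 0) bs = iter m (@ones_step R) z].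
  exact: iter_ones_bounds.
elim: bs => [|b bs [z [z0 zg zE]]] /=; first by exists 0.
exists (pair_step b (iter m (@ones_step R) z)); rewrite zE; split => //.
  exact/ltW/pair_step_gt0/iter_ones_ge0.
apply: pair_step_le_golden; first exact: iter_ones_ge0.
by have /andP[] := iter_ones_bounds m z z0 zg.
Qed.

End Tails.

(** * Words with a dominant letter *)

Section Words.
Variable R : realType.
Implicit Types (L z : R) (b : bool) (m M : nat) (bs : seq bool) (l r : seq nat).
Local Notation g := (golden R).

(* All values [lambda] at the letters of [r] in the word [catrev l r] are at
   most [L]. *)
Fixpoint splits_le L l r : Prop :=
  if r is a :: r' then a%:R + cf R l + cf R r' <= L /\ splits_le L (a :: l) r'
  else True.

Lemma splits_leP L w : splits_le L [::] w ->
  forall l a r, catrev l (a :: r) = w -> a%:R + cf R l + cf R r <= L.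
Proof.
move=> hw; suff H l r : catrev l r = w -> splits_le L l r.
  by move=> l a r /H[].
elim: l r => [|c l IH] r; first by move=> /= ->.
by move=> /(IH (c :: r))[].
Qed.

Lemma cf_le1 l : positive_word l -> cf R l <= 1.
Proof.
case: l => //= a l /andP[a0 _]; have a1 : 1 <= a%:R :> R by rewrite ler1n.
by have l0 := cf_ge0 R l; rewrite invf_le1; lra.
Qed.

(** A letter 1 never exceeds the threshold: both neighbouring values are at most 1, so
    [lambda <= 3]. *)
Lemma splits_le_ones L k l r : 3 <= L -> positive_word l -> positive_word r ->
  splits_le L (nseq k 1%N ++ l) r -> splits_le L l (nseq k 1%N ++ r).
Proof.
move=> L3 + pr; elim: k l => //= k IH l pl h; split.
  have := cf_le1 l pl; suff /cf_le1 : positive_word (nseq k 1%N ++ r) by lra.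
  by rewrite /positive_word all_cat all_nseq orbT.
by apply: IH => //; rewrite -cat1s catA (_ : [:: 1%N] = nseq 1 1%N)// -nseqD addn1.
Qed.

Lemma tail_word_positive m bs : positive_word (tail_word m bs).
Proof.
elim: bs => [|b bs IH] /=; first by rewrite /positive_word all_nseq orbT.
by rewrite /positive_word all_cat all_nseq orbT /= andbA andbb; case: b.
Qed.

Lemma cf_two_le l : cf R (2%N :: l) <= 2^-1.
Proof. by have l0 := cf_ge0 R l; rewrite /= lef_pV2 ?posrE; lra. Qed.

(** The left side equals 3 at [x = y = g]; lowering [y] by at most [4^-m] raises it by at most
    [4^-m]. *)
Lemma near_golden_le3 L m x y : 3 + 4^-1 ^+ m <= L ->
  x <= g -> 0 <= y -> g - 4^-1 ^+ m <= y -> 2 + x + (2 + y)^-1 <= L.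
Proof.
move=> hL xg y0 gy; have /andP[g2 g1] := golden_bounds R.
have gI := golden_inv R.
have m0 : 0 < 4^-1 ^+ m :> R by rewrite exprn_gt0// invr_gt0.
suff : (2 + y)^-1 <= (2 + g)^-1 + 4^-1 ^+ m by lra.
have -> : (2 + y)^-1 = (2 + g)^-1 + (g - y) / ((2 + g) * (2 + y)) by field; lra.
have P1 : 1 <= (2 + g) * (2 + y) by rewrite -[1]mulr1 ler_pM; lra.
rewrite lerD2l ler_pdivrMr; last lra.
by apply: (@le_trans _ _ (4^-1 ^+ m)); [lra | rewrite ler_peMr// ltW].
Qed.

Lemma splits_le_tail_word L m bs l : 3 + 4^-1 ^+ m <= L ->
  positive_word l -> cf R l <= g -> splits_le L l (tail_word m bs).
Proof.
move=> hL; have m0 : 0 < 4^-1 ^+ m :> R by rewrite exprn_gt0// invr_gt0.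
have L3 : 3 <= L by lra.
have /andP[g2 g1] := golden_bounds R.
elim: bs l => [|b bs IH] l pl lg /=.
  by rewrite -[nseq _ _]cats0; exact: splits_le_ones.
have pt := tail_word_positive m bs.
apply: splits_le_ones => //; first by case: (b).
set l1 := nseq _ _ ++ l; set t := tail_word m bs.
have pl1 : positive_word l1 by rewrite /positive_word all_cat all_nseq orbT.
have := iter_ones_bounds R m (cf R l) (cf_ge0 R l) lg.
rewrite -cf_ones -/l1 => /andP[gl1 l1g].
have /andP[gt tg] := cf_tail_word_bounds R m bs; rewrite -/t in gt tg.
have t0 := cf_ge0 R t; have l10 := cf_ge0 R l1.
case: b => /=.
- split; first exact: (near_golden_le3 L m).
  (* At the second 2 of the pair, the left and right contexts exchange roles. *)
  split; first by rewrite addrAC; exact: (near_golden_le3 L m).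
  by apply: IH => //; exact: le_trans (cf_two_le _) (ltW g2).
- have h1 : cf R (1%N :: t) <= 1 by apply: cf_le1.
  have h2 : cf R (1%N :: l1) <= 1 by apply: cf_le1.
  have h3 := cf_le1 _ pt; have h4 := cf_le1 _ pl1.
  rewrite /= -/t in h1 h2 h3; split; first lra.
  split; first lra.
  apply: IH => //; have := pair_step_le_golden R false (cf R l1) l10 l1g.
  by [].
Qed.

Definition peak_prefix M : seq nat := nseq M.*2.+1 1%N.

Lemma cf_peak_prefix M : cf R (peak_prefix M) = iter M (@ones_step R) 1.
Proof. by rewrite /peak_prefix -addn1 nseqD cf_ones /= addr0 invr1. Qed.

(** The odd length makes the iteration start from 1, above the fixed point [g]. *)
Lemma cf_peak_prefix_gt M : g < cf R (peak_prefix M).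
Proof.
have /andP[g2 g1] := golden_bounds R.
rewrite cf_peak_prefix -{1}(iter_ones_golden R M); apply: iter_ones_lt => //.
by lra.
Qed.

Lemma cf_peak_prefix_le M : cf R (peak_prefix M) <= g + 4^-1 ^+ M.
Proof.
rewrite cf_peak_prefix.
have := @iter_ones_contract R M 1 ler01 (lexx 1); rewrite ler_norml.
by move=> /andP[_]; lra.
Qed.

(* The value [lambda] at the first 2 of [1^(2M+1) 2 2 t] when [t] has value [z]. *)
Definition peak M z : R := 2 + cf R (peak_prefix M) + (2 + z)^-1.

Lemma peak_gt3 M z : 0 <= z -> z <= g -> 3 + (cf R (peak_prefix M) - g) <= peak M z.
Proof.
move=> z0 zg; have gI := golden_inv R.
suff : (2 + g)^-1 <= (2 + z)^-1 by rewrite /peak; lra.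
by rewrite lef_pV2 ?posrE; lra.
Qed.

(** The hypothesis puts the peak above [3 + 4^-m], which dominates every letter of the tail. *)
Lemma peak_Zspectrum M m bs : 4^-1 ^+ m <= cf R (peak_prefix M) - g ->
  Zspectrum (peak M (cf R (tail_word m bs)))^-1.
Proof.
move=> hm; set t := tail_word m bs.
have pt : positive_word t := tail_word_positive m bs.
have pp : positive_word (peak_prefix M).
  by rewrite /positive_word all_nseq orbT.
have /andP[g2 g1] := golden_bounds R.
have /andP[_ tg] := cf_tail_word_bounds R m bs; rewrite -/t in tg.
have t0 := cf_ge0 R t; have L3 := peak_gt3 M _ t0 tg.
have m0 : 0 < 4^-1 ^+ m :> R by rewrite exprn_gt0// invr_gt0.
have pg := cf_peak_prefix_gt M; have gI := golden_inv R.
have pw : positive_word (catrev (peak_prefix M) [:: 2%N, 2%N & t]).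
  by rewrite positive_word_catrev pp.
apply: (Zspectrum_word _ _ _ _ _ pw) => //.
  rewrite ctn_catrev; apply/ltn_addr/(@leq_mul 1 2); first exact: ctn_gt0.
  by have := ctn_gt0 _ pt; rewrite /=; lia.
have -> : catrev (peak_prefix M) [:: 2%N, 2%N & t] =
    peak_prefix M ++ [:: 2%N, 2%N & t].
  by rewrite catrevE /peak_prefix rev_nseq.
apply: splits_leP; apply: splits_le_ones => //; first lra.
rewrite cats0 -/(peak_prefix M); split; first by rewrite lexx.
split.
  (* At the second 2, [lambda] is at most [2 + (1 - g) + g = 3]. *)
  have : cf R (2%N :: peak_prefix M) <= (2 + g)^-1.
    rewrite -[cf R _]/((2 + cf R (peak_prefix M))^-1).
    by rewrite lef_pV2 ?posrE; lra.
  by rewrite gI; lra.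
apply: splits_le_tail_word => //; first lra.
exact: le_trans (cf_two_le _) (ltW g2).
Qed.

End Words.

(** * The Cantor set of limits *)

Section CantorSet.
Variables (R : realType) (m : nat).
Hypothesis m_gt0 : (0 < m)%N.
Local Notation g := (golden R).
Implicit Types (x y : nat -> bool) (n i : nat).

Definition tail_cf x n : R := cf R (tail_word m (mkseq x n)).

Definition tail_lim x : R := sup (range (tail_cf x)).

Lemma start_gt0 : 0 < iter m (@ones_step R) 0.
Proof.
case: m m_gt0 => // k _; apply: (@le_lt_trans _ _ (iter k (@ones_step R) 0)).
  exact: iter_ones_ge0.
rewrite iterSr; apply: iter_ones_lt => //.
by rewrite /ones_step addr0 invr1 invr_gt0.
Qed.

(** A further block replaces the innermost seed 0 by a positive [pair_step] value, and all outer
    maps are increasing. *)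
Lemma tail_cf_lt x n : tail_cf x n < tail_cf x n.+1.
Proof.
rewrite /tail_cf !cf_tail_word mkseqS foldr_rcons.
have z0 := ltW start_gt0; set z := iter m _ _ in z0 *.
have zz : z < block_step R m (x n) z.
  by apply: iter_ones_lt => //; exact: pair_step_gt0.
by have /andP[] := foldr_block_step_lt R m (mkseq x n) _ _ z0 zz.
Qed.

Lemma tail_cf_le x : {homo tail_cf x : n k / (n <= k)%N >-> n <= k}.
Proof. by apply/nondecreasing_seqP => n; exact/ltW/tail_cf_lt. Qed.

Lemma tail_cf_ubound x : ubound (range (tail_cf x)) g.
Proof.
by move=> _ [n _ <-]; have /andP[] := cf_tail_word_bounds R m (mkseq x n).
Qed.

Lemma tail_lim_le_golden x : tail_lim x <= g.
Proof. by apply: ge_sup; [exists (tail_cf x 0), 0%N | exact: tail_cf_ubound]. Qed.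

Lemma tail_cf_le_lim x n : tail_cf x n <= tail_lim x.
Proof.
by apply: ub_le_sup; [exists g; exact: tail_cf_ubound | exists n].
Qed.

Lemma tail_cf_cvg x : tail_cf x n @[n --> \oo] --> tail_lim x.
Proof.
apply: nondecreasing_cvgn; first exact: tail_cf_le.
by exists g; exact: tail_cf_ubound.
Qed.

Lemma tail_lim_ge0 x : 0 <= tail_lim x.
Proof. exact: le_trans (cf_ge0 R _) (tail_cf_le_lim x 0). Qed.

(** At the first difference, digit 2 keeps all values of [x] below a bound built from 1/2, which
    digit 1 already exceeds at a finite stage of [y]. *)
Lemma tail_lim_lt x y i : mkseq x i = mkseq y i -> x i -> ~~ y i ->
  tail_lim x < tail_lim y.
Proof.
move=> xy xi yi; have z0 := start_gt0.
pose half := iter m (@ones_step R) 2^-1.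
have lim_le : tail_lim x <= foldr (block_step R m) half (mkseq x i).
  apply: ge_sup; first by exists (tail_cf x 0), 0%N.
  (* Lengthening to [i + n.+1] ensures that digit [i] is present. *)
  move=> _ [n _ <-]; apply: le_trans (tail_cf_le x n (i + n.+1) _) _; first lia.
  rewrite /tail_cf cf_tail_word /mkseq iotaD map_cat foldr_cat /= add0n xi.
  rewrite -cf_tail_word; set z := cf R _; have zge0 : 0 <= z := cf_ge0 R _.
  apply: foldr_block_step_le; first exact: block_step_ge0.
  by apply: iter_ones_le; [exact/ltW/pair_step_gt0 | exact: pair_step_true_le].
apply: (le_lt_trans lim_le); apply: lt_le_trans (tail_cf_le_lim y i.+1).
rewrite /tail_cf cf_tail_word mkseqS foldr_rcons -xy (negbTE yi).
have h : half < block_step R m false (iter m (@ones_step R) 0).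
  apply: iter_ones_lt => //.
  have := @pair_step_lt R false 0 _ (lexx 0) z0.
  by rewrite /pair_step /= addr0 invr1.
have half0 : 0 <= half by apply: iter_ones_ge0.
by have /andP[] := foldr_block_step_lt R m (mkseq x i) _ _ half0 h.
Qed.

Lemma tail_lim_inj : injective tail_lim.
Proof.
move=> x y; apply: contraPP => xy.
have : exists n, x n != y n.
  apply: contrapT => h; apply: xy; apply/funext => n; apply/eqP.
  by apply: contrapT => /negP hn; apply: h; exists n.
move=> /ex_minnP[i xyi imin].
have pre : mkseq x i = mkseq y i.
  apply/eq_in_map => k; rewrite mem_iota => /andP[_ ki]; apply/eqP.
  by apply: contraTT ki => /imin; rewrite -leqNgt.
case xi : (x i) xyi; case yi : (y i) => // _ /eqP.
- by rewrite lt_eqF// (tail_lim_lt _ _ i pre)// ?xi ?yi.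
- by rewrite gt_eqF// (tail_lim_lt _ _ i (esym pre))// ?xi ?yi.
Qed.

End CantorSet.

(** * Uncountability and choice of parameters *)

(** Cantor's diagonal argument: [d] contradicts itself at the index [h (F d)]. *)
Lemma uncountable_range (T : Type) (F : (nat -> bool) -> T) (A : set T) :
  injective F -> (forall x, A (F x)) -> ~ countable A.
Proof.
move=> Finj FA /countable_injP[h hinj].
pose d n := `[< exists x : nat -> bool, h (F x) = n /\ ~~ x n >].
have [dn|/negP dn] := boolP (d (h (F d))).
  have /asboolP[x [/hinj xd xn]] := dn.
  by move: xn; rewrite (Finj _ _ (xd _ _)) ?inE// dn.
by apply: (dn); apply/asboolP; exists d; split=> //; exact/negP.
Qed.

(** The successor exponent supplies the positive [m] required for strict growth of the tails. *)
Lemma exp4V_lt (R : realType) (e : R) : 0 < e -> exists n, 4^-1 ^+ n.+1 < e.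
Proof.
move=> /ltr_add_invr[k]; rewrite add0r => ke; exists k.
apply: le_lt_trans ke; rewrite exprVn lef_pV2 ?posrE ?exprn_gt0//.
by rewrite -natrX ler_nat ltnW// ltn_expl.
Qed.

Theorem theorem2 (R : realType) (eps : R) : 0 < eps ->
  ~ countable (limit_point (@Zspectrum R) `&` `]3^-1 - eps, 3^-1[).
Proof.
move=> eps0; have [M /= hM] := exp4V_lt R eps eps0.
set N := M.+1 in hM; have pg := cf_peak_prefix_gt R N.
have pN := cf_peak_prefix_le R N.
have dN : 0 < cf R (peak_prefix N) - golden R by rewrite subr_gt0.
(* Here [m] is chosen after [N], so that [4^-m] is below the excess of the prefix over [g]. *)
have [k hk] := exp4V_lt R _ dN.
pose m := k.+1; have m0 : (0 < m)%N by [].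
apply: (uncountable_range _ (fun x => (peak R N (tail_lim R m x))^-1)).
  move=> x y /invr_inj/addrI/invr_inj/addrI.
  exact: tail_lim_inj.
move=> x; set t := tail_lim R m x.
have t0 : 0 <= t := tail_lim_ge0 R m x.
have tg : t <= golden R := tail_lim_le_golden R m x.
have /andP[g2 g1] := golden_bounds R.
have L3 := peak_gt3 R N t t0 tg.
split; last first.
  (* One [eps] covers the excess of the prefix over [g], the other the deviation [4^-m] of the
     tail. *)
  have Lle : peak R N t <= 3 + 2 * eps.
    have gt : golden R - 4^-1 ^+ m <= t.
      have /andP[+ _] := cf_tail_word_bounds R m (mkseq x 0).
      by move=> /le_trans; apply; exact: (tail_cf_le_lim R m x 0).
    have := near_golden_le3 R _ m _ _ (lexx _) (lexx _) t0 gt.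
    by rewrite /peak; move: hk hM pN pg; rewrite -/m; lra.
  have P0 : 0 < peak R N t by lra.
  rewrite /= in_itv /=; apply/andP; split; last by rewrite ltf_pV2 ?posrE; lra.
  rewrite ltrBlDr -subr_gt0.
  have -> : (peak R N t)^-1 + eps - 3^-1 =
    (3 - peak R N t + 3 * eps * peak R N t) / (3 * peak R N t) by field; lra.
  by rewrite divr_gt0//; nra.
(* The finite words give spectrum elements converging to the limit; strict growth of the tails keeps
   them distinct from it. *)
apply/limit_pointP; exists (fun n => (peak R N (tail_cf R m x n))^-1); split.
- by move=> _ [n _ <-]; apply: peak_Zspectrum; exact: ltW.
- move=> n; apply/negP => /eqP/invr_inj/addrI/invr_inj/addrI.
  apply/eqP; rewrite lt_eqF//.
  exact: lt_le_trans (tail_cf_lt R m m0 x n) (tail_cf_le_lim R m x n.+1).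
- apply: cvgV; first by rewrite gt_eqF//; lra.
  apply: cvgD; first exact: cvg_cst.
  apply: cvgV; first by rewrite gt_eqF//; lra.
  by apply: cvgD; [exact: cvg_cst | exact: tail_cf_cvg].
Qed.
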